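(* Let $n\ge 2$ and let $\boldsymbol{\omega}=(\omega_1,\dots,\omega_n)$ be a positive Chebyshev system on an interval $I\subset\mathbb{R}$ such that $(\omega_1,\dots,\omega_{n-1})$ is also a positive Chebyshev system on $I$. A function $f:I\to\mathbb{R}$ is $\boldsymbol{\omega}$-$n$-convex if and only if for all $x_1,\dots,x_{n-1}\in I^0$ such that $x_1<\dots<x_{n-1}$ the function $x\mapsto[x_1,\dots,x_{n-1},x;f]_{\boldsymbol{\omega}}$ is nondecreasing on the set $I\setminus\{x_1,\dots,x_{n-1}\}$.
   Context: Let $I\subset\mathbb{R}$ be an interval, $I^0$ its interior, and $\omega_1,\dots,\omega_n:I\to\mathbb{R}$ continuous functions. For $m\in\{n-1,n\}$ and $m$ distinct points $y_1,\dots,y_m\in I$ put $V_m(y_1,\dots,y_m)=\det\bigl(\omega_i(y_j)\bigr)_{i,j=1}^m$ (row $i$ corresponds to the function $\omega_i$, column $j$ to the point $y_j$). For $f:I\to\mathbb{R}$ and $m+1$ distinct points $y_1,\dots,y_{m+1}\in I$ let $D_m(y_1,\dots,y_{m+1};f)$ be the determinant of the $(m+1)\times(m+1)$ matrix whose $i$-th row, for $i=1,\dots,m$, is $(\omega_i(y_1),\dots,\omega_i(y_{m+1}))$ and whose last row is $(f(y_1),\dots,f(y_{m+1}))$. A system $(\omega_1,\dots,\omega_m)$ of continuous functions is a Chebyshev system on $I$ if $V_m(y_1,\dots,y_m)\neq 0$ for all $y_1<\dots<y_m$ in $I$; it is a positive Chebyshev system if $V_m(y_1,\dots,y_m)>0$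 for all $y_1<\dots<y_m$ in $I$. If $(\omega_1,\dots,\omega_n)$ and $(\omega_1,\dots,\omega_{n-1})$ are Chebyshev systems on $I$, the generalized divided difference at $n$ distinct points $y_1,\dots,y_n\in I$ (in any order) is $$[y_1,\dots,y_n;f]_{\boldsymbol{\omega}}=\frac{D_{n-1}(y_1,\dots,y_n;f)}{V_n(y_1,\dots,y_n)}.$$ For a Chebyshev system $\boldsymbol{\omega}=(\omega_1,\dots,\omega_n)$ on $I$, a function $f:I\to\mathbb{R}$ is $\boldsymbol{\omega}$-$n$-convex if for any $x_1<\dots<x_n$ in $I$ the (uniquely determined) function $\omega=c_1\omega_1+\dots+c_n\omega_n$ (with $c_1,\dots,c_n\in\mathbb{R}$) such that $\omega(x_i)=f(x_i)$, $i=1,\dots,n$, satisfies, for $x\in I$: $(-1)^n(f(x)-\omega(x))\ge 0$ for $x\le x_1$; $(-1)^{n+i}(f(x)-\omega(x))\ge 0$ for $x_i\le x\le x_{i+1}$, $i=1,\dots,n-1$; and $f(x)-\omega(x)\ge 0$ for $x\ge x_n$. *)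

(* Defs.v *)
From HB Require Import structures.
From mathcomp Require Import all_boot all_order all_algebra.
From mathcomp Require Import all_classical all_reals all_analysis.

Set Implicit Arguments.
Unset Strict Implicit.
Unset Printing Implicit Defensive.

Import Order.TTheory GRing.Theory Num.Theory.
Import numFieldNormedType.Exports.

Local Open Scope classical_set_scope.
Local Open Scope ring_scope.

(* Indices are 0-based.  Functions on an interval I are represented by total
   functions R -> R; only their values on I are ever used. *)

Definition append (T : Type) (m : nat) (u : 'I_m -> T) (a : T) : 'I_m.+1 -> T :=
  fun j => oapp u a (unlift ord_max j).

Definition init (T : Type) (m : nat) (u : 'I_m.+1 -> T) : 'I_m -> T :=
  fun i => u (widen_ord (leqnSn m) i).

Definition increasing_in (R : realType) (I : set R) (m : nat) (y : 'I_m -> R)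
    : Prop :=
  (forall i, I (y i)) /\ (forall i j : 'I_m, (i < j)%N -> y i < y j).

Definition V (R : realType) (m : nat) (w : 'I_m -> R -> R) (y : 'I_m -> R) : R :=
  \det (\matrix_(i < m, j < m) w i (y j)).

Definition D (R : realType) (m : nat) (w : 'I_m -> R -> R) (y : 'I_m.+1 -> R)
    (f : R -> R) : R :=
  \det (\matrix_(i < m.+1, j < m.+1) append w f i (y j)).

Definition chebyshev (R : realType) (I : set R) (m : nat) (w : 'I_m -> R -> R)
    : Prop :=
  (forall i, {within I, continuous (w i)}) /\
  (forall y : 'I_m -> R, increasing_in I y -> V w y != 0).

Definition positive_chebyshev (R : realType) (I : set R) (m : nat)
    (w : 'I_m -> R -> R) : Prop :=
  (forall i, {within I, continuous (w i)}) /\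
  (forall y : 'I_m -> R, increasing_in I y -> 0 < V w y).

Definition divided_difference (R : realType) (m : nat) (w : 'I_m.+1 -> R -> R)
    (y : 'I_m.+1 -> R) (f : R -> R) : R :=
  D (init w) y f / V w y.

Definition lincomb (R : realType) (m : nat) (w : 'I_m -> R -> R) (c : 'I_m -> R)
    : R -> R :=
  fun t => \sum_(i < m) c i * w i t.

(* The interpolating combination in [omega_convex] exists and is unique. *)
Lemma interpolant_unique (R : realType) (I : set R) (m : nat)
    (w : 'I_m -> R -> R) (f : R -> R) (x : 'I_m -> R) :
  chebyshev I w -> increasing_in I x ->
  exists! c : 'I_m -> R, forall i, lincomb w c (x i) = f (x i).
Proof.
move=> [_ wV] xI; have := wV x xI; rewrite /V.
set A := (X in \det X) => detA.
have Au : A \in unitmx by rewrite unitmxE unitfE.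
have rowE (c : 'I_m -> R) j :
    ((\row_i c i) *m A) 0 j = lincomb w c (x j).
  by rewrite mxE; apply: eq_bigr => i _; rewrite !mxE.
pose F : 'rV[R]_m := \row_j f (x j).
exists (fun i => (F *m invmx A) 0 i); split.
  move=> j; rewrite -rowE.
  have -> : \row_i (F *m invmx A) 0 i = F *m invmx A.
    by apply/rowP => i; rewrite mxE.
  by rewrite mulmxKV // mxE.
move=> c cP; apply/funext => i.
have -> : F = (\row_k c k) *m A.
  by apply/rowP => j; rewrite rowE cP mxE.
by rewrite mulmxK // mxE.
Qed.

(* Here n = m.+1.  In the middle clause the 0-based index i stands for the
   1-based index i.+1, whence the exponent n + i.+1. *)
Definition omega_convex (R : realType) (I : set R) (m : nat)
    (w : 'I_m.+1 -> R -> R) (f : R -> R) : Prop :=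
  forall x : 'I_m.+1 -> R, increasing_in I x ->
  exists c : 'I_m.+1 -> R,
    (forall i, lincomb w c (x i) = f (x i)) /\
    forall t, I t ->
      [/\ t <= x ord0 -> 0 <= (-1) ^+ m.+1 * (f t - lincomb w c t),
          forall i j : 'I_m.+1, j = i.+1 :> nat -> x i <= t <= x j ->
            0 <= (-1) ^+ (m.+1 + i.+1) * (f t - lincomb w c t)
        & x ord_max <= t -> 0 <= f t - lincomb w c t].

(* Main.v *)
Require Import Defs.
From HB Require Import structures.
From mathcomp Require Import all_boot all_order all_algebra.
From mathcomp Require Import perm.
From mathcomp Require Import all_classical all_reals all_analysis.
From mathcomp Require Import zify ring.

(** With [n = m.+1], both conditions say that the bordered determinant
    [D w z f] is nonnegative for every increasing [(n+1)]-tuple [z] of points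
    of [I].

    For convexity ([omega_convex_D]): if [g] interpolates [f] at [x], then
    subtracting [g] from the last row gives
    [D w (append x t) f = (f t - g t) * V w x] ([D_interpolation_error]), and
    moving [t] from the last column to the place [p] that it has among the
    points of [x] multiplies the determinant by [(-1) ^+ (p + n)]
    ([V_insert]).  The signs required of [f - g] are exactly these.

    For monotonicity, the same subtraction yields the identity
    [divided_differenceB]: the increment of the divided difference from [s] to
    [t] is the bordered determinant at [x], [s], [t], times
    [V (init w) x], divided by the two determinants [V] at [x], [s] and at
    [x], [t].  If [s < t], sorting [s] into [x] and then [t] into the result
    changes the sign of the numerator just as it changes the sign of the
    denominator, so nonnegative bordered determinants give a nondecreasing
    divided difference ([divided_difference_le]).  Conversely, given [z], take
    [s] and [t] to be its first and last points and [x] the points in between,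
    which lie in the interior of [I] since [I] is an interval; all factors
    other than the bordered determinant are then positive. *)

Import Order.TTheory GRing.Theory Num.Theory.
Import numFieldNormedType.Exports.

Local Open Scope classical_set_scope.
Local Open Scope ring_scope.

Set Implicit Arguments.
Unset Strict Implicit.

(** * Inserting a point into a tuple of points *)

Definition insert (T : Type) (k : nat) (p : 'I_k.+1) (u : 'I_k -> T) (a : T) :
    'I_k.+1 -> T :=
  fun j => oapp u a (unlift p j).

Lemma insert_at (T : Type) k (p : 'I_k.+1) (u : 'I_k -> T) a :
  insert p u a p = a.
Proof. by rewrite /insert unlift_none. Qed.

Lemma insert_lift (T : Type) k (p : 'I_k.+1) (u : 'I_k -> T) a i :
  insert p u a (lift p i) = u i.
Proof. by rewrite /insert liftK. Qed.

Lemma append_max (T : Type) k (u : 'I_k -> T) a : append u a ord_max = a.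
Proof. exact: insert_at. Qed.

Lemma append_lift (T : Type) k (u : 'I_k -> T) a i :
  append u a (lift ord_max i) = u i.
Proof. exact: insert_lift. Qed.

Lemma init_lift (T : Type) k (u : 'I_k.+1 -> T) :
  init u = fun i => u (lift ord_max i).
Proof.
by apply/funext => i; rewrite /init; congr u; apply/val_inj/esym/lift_max.
Qed.

Lemma init_append (T : Type) k (u : 'I_k -> T) a : init (append u a) = u.
Proof. by rewrite init_lift; apply/funext => i; rewrite append_lift. Qed.

Lemma insert_split (T : Type) k (p : 'I_k.+1) (u : 'I_k.+1 -> T) :
  insert p (fun i => u (lift p i)) (u p) = u.
Proof.
apply/funext => j; case: (unliftP p j) => [i ->|->].
  by rewrite insert_lift.
by rewrite insert_at.
Qed.

Lemma append_init (T : Type) k (u : 'I_k.+1 -> T) :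
  append (init u) (u ord_max) = u.
Proof. by rewrite init_lift; exact: insert_split. Qed.

(** * Determinants and divided differences *)

Section Determinants.
Variable R : realType.
Implicit Types f g h : R -> R.

(** The permutation that carries the last place to place [p] and keeps the
    order of the others is a cycle of length [k - p + 1]. *)
Lemma V_insert k (w : 'I_k.+1 -> R -> R) (p : 'I_k.+1) (x : 'I_k -> R) t :
  V w (insert p x t) = (-1) ^+ (p + k) * V w (append x t).
Proof.
rewrite /V.
set A := (\matrix_(i, j) w i (insert p x t j)).
have -> : (\matrix_(i, j) w i (append x t j)) =
    col_perm (lift_perm ord_max p 1) A.
  apply/matrixP => i j; rewrite !mxE; congr (w i _).
  case: (unliftP ord_max j) => [j' ->|->].
    by rewrite lift_perm_lift perm1 append_lift insert_lift.
  by rewrite lift_perm_id append_max insert_at.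
rewrite col_permE det_mulmx det_perm odd_permV odd_lift_perm odd_perm1 addbF.
rewrite mulrCA -signr_odd oddD addbC.
by rewrite -signr_addb addbb expr0 mulr1.
Qed.

Lemma D_insert k (w : 'I_k -> R -> R) (p : 'I_k.+1) (x : 'I_k -> R) t f :
  D w (insert p x t) f = (-1) ^+ (p + k) * D w (append x t) f.
Proof. exact: V_insert. Qed.

(** Both determinants change by the same sign. *)
Lemma divided_difference_insert k (w : 'I_k.+1 -> R -> R) (p : 'I_k.+1)
    (x : 'I_k -> R) t f :
  divided_difference w (insert p x t) f = divided_difference w (append x t) f.
Proof.
rewrite /divided_difference D_insert V_insert.
by rewrite -mulf_div divff ?mul1r ?signr_eq0.
Qed.

(** The cofactors of the last row do not involve [f], so [D w y] is linear in
    [f]. *)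
Lemma D_expand k (w : 'I_k -> R -> R) (y : 'I_k.+1 -> R) :
  exists K : 'I_k.+1 -> R, forall f, D w y f = \sum_j f (y j) * K j.
Proof.
(* The last row [cst 0] is a dummy: these cofactors delete it. *)
exists (cofactor (\matrix_(i, j) append w (cst 0) i (y j)) ord_max) => f.
rewrite /D (expand_det_row _ ord_max); apply: eq_bigr => j _.
rewrite mxE append_max; congr (_ * (_ * \det _)).
by apply/matrixP => i l; rewrite !mxE !append_lift.
Qed.

Lemma D_row k (w : 'I_k -> R -> R) y i : D w y (w i) = 0.
Proof.
apply: (@determinant_alternate _ _ _ (lift ord_max i) ord_max).
  by rewrite eq_sym neq_lift.
by move=> j; rewrite !mxE append_lift append_max.
Qed.

Lemma D_last k (w : 'I_k.+1 -> R -> R) y : D (init w) y (w ord_max) = V w y.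
Proof. by rewrite /D append_init. Qed.

Lemma D_sub_lincomb k l (w : 'I_k -> R -> R) (v : 'I_l -> R -> R) c y f :
  D w y (fun t => f t - lincomb v c t) =
  D w y f - \sum_i c i * D w y (v i).
Proof.
have [K DK] := D_expand w y; rewrite !DK.
under [X in _ = _ - X]eq_bigr => i _ do rewrite DK mulr_sumr.
rewrite exchange_big /= -sumrB; apply: eq_bigr => j _.
rewrite /lincomb mulrBl mulr_suml; congr (_ - _).
by apply: eq_bigr => i _; rewrite mulrA.
Qed.

Lemma D_sub_span k (w : 'I_k -> R -> R) c y f :
  D w y (fun t => f t - lincomb w c t) = D w y f.
Proof.
by rewrite D_sub_lincomb big1 ?subr0 // => i _; rewrite D_row mulr0.
Qed.

(** Subtracting a combination of the system shifts every divided difference by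
    the same constant, the coefficient of the last function; hence differences
    of divided differences are not affected. *)
Lemma divided_difference_sub_span k (w : 'I_k.+1 -> R -> R) c y f :
  V w y != 0 ->
  divided_difference w y (fun t => f t - lincomb w c t) =
  divided_difference w y f - c ord_max.
Proof.
move=> Vy; rewrite /divided_difference D_sub_lincomb (bigD1 ord_max) //= D_last.
rewrite big1 ?addr0 => [|i]; first by rewrite mulrBl mulfK.
case: (unliftP ord_max i) => [j -> _|->]; last by rewrite eqxx.
suff -> : w (lift ord_max j) = init w j by rewrite D_row mulr0.
by rewrite init_lift.
Qed.

Lemma D_append0 k (w : 'I_k -> R -> R) x t h :
  (forall i, h (x i) = 0) -> D w (append x t) h = h t * V w x.
Proof.
move=> h0; rewrite /D (expand_det_row _ ord_max) (bigD1 ord_max) //=.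
rewrite big1 ?addr0.
  rewrite mxE !append_max /cofactor -signr_odd oddD addbb mul1r.
  congr (_ * \det _); apply/matrixP => i j.
  by rewrite !mxE !append_lift.
move=> j; case: (unliftP ord_max j) => [i -> _|->]; last by rewrite eqxx.
by rewrite mxE append_max append_lift h0 mul0r.
Qed.

Lemma D_zero k (w : 'I_k -> R -> R) y h :
  (forall j, h (y j) = 0) -> D w y h = 0.
Proof.
move=> h0; have [K ->] := D_expand w y.
by rewrite big1 // => j _; rewrite h0 mul0r.
Qed.

(** Subtracting the interpolant from [f] does not change the determinant, and
    leaves a single nonzero entry in the last row, at [t]. *)
Lemma D_interpolation_error k (w : 'I_k -> R -> R) c x t f :
  (forall i, lincomb w c (x i) = f (x i)) ->
  D w (append x t) f = (f t - lincomb w c t) * V w x.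
Proof.
move=> cP; have h0 i : f (x i) - lincomb w c (x i) = 0 by rewrite cP subrr.
by rewrite -(D_sub_span w c) (D_append0 _ _ h0).
Qed.

Lemma positive_chebyshevW (I : set R) k (w : 'I_k -> R -> R) :
  positive_chebyshev I w -> Defs.chebyshev I w.
Proof. by move=> [cont Vpos]; split=> // y /Vpos /lt0r_neq0. Qed.

Lemma interpolant_exists (I : set R) k (w : 'I_k -> R -> R) (x : 'I_k -> R) f :
  Defs.chebyshev I w -> increasing_in I x ->
  exists c, forall i, lincomb w c (x i) = f (x i).
Proof.
by move=> hw xI; have [c []] := interpolant_unique f hw xI; exists c.
Qed.

(** The increment of the divided difference is a bordered determinant of order
    [k.+2] up to known factors.  Both sides are unchanged when [f] is replaced
    by [f - g], with [g] the interpolant of [f] at [x] and [s].  Then the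
    divided difference at [x] and [s] vanishes, and the last rows of the other
    two numerators vanish except at [t].  The point [s] is inserted at an arbitrary place so that the points
    of the first factor can be taken in increasing order. *)
Lemma divided_differenceB (I : set R) k (w : 'I_k.+1 -> R -> R) (p : 'I_k.+1)
    x s t f :
  Defs.chebyshev I w -> increasing_in I (insert p x s) ->
  V w (append x t) != 0 ->
  (divided_difference w (append x t) f - divided_difference w (append x s) f) *
    (V w (insert p x s) * V w (append x t)) =
  D w (append (insert p x s) t) f * V (init w) x.
Proof.
move=> hw yI Vt; have Vs := hw.2 _ yI.
have [c cP] := interpolant_exists f hw yI.
pose h u := f u - lincomb w c u.
have h0 j : h (insert p x s j) = 0 by rewrite /h cP subrr.
have hx i : h (x i) = 0 by have := h0 (lift p i); rewrite insert_lift.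
rewrite -(divided_difference_insert w p x s) (D_interpolation_error _ cP).
have -> : divided_difference w (append x t) f -
    divided_difference w (insert p x s) f =
  divided_difference w (append x t) h - divided_difference w (insert p x s) h.
  by rewrite !divided_difference_sub_span //; ring.
rewrite /divided_difference (D_zero _ h0) mul0r subr0 (D_append0 _ _ hx).
by rewrite /h; field.
Qed.

End Determinants.

(** * The rank of a point among ordered points *)

Section Rank.
Variables (R : realType) (I : set R).

(** For increasing [x], the place at which inserting [t] keeps the order. *)
Definition is_rank k (x : 'I_k -> R) (t : R) (p : 'I_k.+1) : Prop :=
  forall i : 'I_k, if (i < p)%N then x i < t else t < x i.

Lemma rank_exists k (x : 'I_k -> R) t :
  increasing_in I x -> ~ range x t -> exists p, is_rank x t p.
Proof.
move=> [_ xlt] tx.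
pose P p := [forall i : 'I_k, (p <= i)%N ==> (t < x i)].
have exP : exists p, P p.
  by exists k; apply/forallP => i; rewrite leqNgt ltn_ord.
case: (ex_minnP exP) => p /forallP Pp pmin.
have pk : (p < k.+1)%N.
  by rewrite ltnS; apply: pmin; apply/forallP => i; rewrite leqNgt ltn_ord.
exists (Ordinal pk) => i /=; case: ltnP => ip.
  2: by have /implyP := Pp i; apply.
rewrite ltNge; apply/negP => txi.
have {}txi : t < x i.
  by rewrite lt_neqAle txi andbT; apply/eqP => e; apply: tx; exists i.
suff /pmin : P i by rewrite leqNgt ip.
apply/forallP => j; apply/implyP.
rewrite leq_eqVlt => /orP[/eqP/val_inj<- //|ij].
exact: lt_trans txi (xlt _ _ ij).
Qed.

Lemma increasing_insert k (x : 'I_k -> R) t p :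
  increasing_in I x -> I t -> is_rank x t p -> increasing_in I (insert p x t).
Proof.
move=> [xI xlt] It px; split=> [j|i j].
  by case: (unliftP p j) => [i ->|->]; rewrite ?insert_lift ?insert_at.
case: (unliftP p i) => [i' ->|->]; case: (unliftP p j) => [j' ->|->];
  rewrite ?insert_lift ?insert_at /= /bump ?ltnn //.
- by move=> ij; apply: xlt; lia.
- by move=> ij; have := px i'; case: ltnP => //; lia.
- by move=> ij; have := px j'; case: ltnP => //; lia.
Qed.

(** A smaller point inserted below [t] raises the rank of [t] by one. *)
Lemma rank_insert k (x : 'I_k -> R) s t p q :
  s < t -> increasing_in I x -> is_rank x s p -> is_rank x t q ->
  is_rank (insert p x s) t (lift ord0 q).
Proof.
move=> st [_ xlt] px qx.
have pq : (p <= q)%N.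
  rewrite leqNgt; apply/negP => qp.
  have qk : (q < k)%N by have := ltn_ord p; lia.
  have := px (Ordinal qk); have := qx (Ordinal qk).
  by rewrite /= ltnn qp => /(lt_trans st) /lt_trans /[apply]; rewrite ltxx.
move=> i; case: (unliftP p i) => [i' ->|->]; rewrite ?insert_lift ?insert_at /=.
  have := qx i'; have := px i'.
  suff -> : (bump p i' < bump 0 q)%N = (i' < q)%N by [].
  by rewrite /bump; lia.
by rewrite /bump /= ifT //; lia.
Qed.

End Rank.

(** * Convexity and the sign of the bordered determinant *)

Section Convexity.
Variables (R : realType) (I : set R) (m : nat) (w : 'I_m.+1 -> R -> R).
Variable f : R -> R.
Hypothesis hw : positive_chebyshev I w.

Lemma increasing_sub k l (g : 'I_k -> 'I_l) (z : 'I_l -> R) :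
  {homo g : i j / (i < j)%N} -> increasing_in I z -> increasing_in I (z \o g).
Proof. by move=> gm [zI zlt]; split=> [i|i j /gm]; [exact: zI|exact: zlt]. Qed.

(** The sign of the interpolation error to the right of all nodes already
    determines the sign of every bordered determinant, by taking the last point
    of [z] as [t]; the signs elsewhere follow by sorting [t] into [x]. *)
Lemma omega_convex_D :
  omega_convex I w f <-> (forall z, increasing_in I z -> 0 <= D w z f).
Proof.
split=> [cvx z zI|Dge0 x xI].
  have zI' : increasing_in I (init z) by apply: increasing_sub zI => i j.
  have [c [cP /(_ (z ord_max))]] := cvx _ zI'.
  case; first exact: zI.1.
  move=> _ _ above.
  rewrite -(append_init z) (D_interpolation_error _ cP).
  apply: mulr_ge0; last exact/ltW/hw.2.
  by apply/above/ltW; apply: zI.2; rewrite /=.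
have [c cP] := interpolant_exists f (positive_chebyshevW hw) xI.
exists c; split=> // t It.
have [[i _ <-]|tx] := pselect (range x t).
  by rewrite cP subrr; split=> *; rewrite ?mulr0.
have [p px] := rank_exists xI tx.
have main : 0 <= (-1) ^+ (p + m.+1) * (f t - lincomb w c t).
  have := Dge0 _ (increasing_insert xI It px).
  by rewrite D_insert (D_interpolation_error _ cP) mulrA pmulr_lge0 // hw.2.
split.
- move=> tx0; have := px ord0; case: ltnP => [_ /lt_le_trans/(_ tx0)|p0 _].
    by rewrite ltxx.
  by move: main; have -> : p = 0%N :> nat by move: p0 => /=; lia.
- move=> i j ji /andP[xit txj].
  have := px i; case: ltnP => [ip _|_ /lt_le_trans/(_ xit)].
  2: by rewrite ltxx.
  have := px j; case: ltnP => [_ /lt_le_trans/(_ txj)|jp _].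
    by rewrite ltxx.
  by rewrite addnC; have -> : i.+1 = p by lia.
- move=> xt; have := px ord_max.
  case: ltnP => [/= pm _|_ /lt_le_trans/(_ xt)]; last by rewrite ltxx.
  have pE : p = m.+1 :> nat by have := ltn_ord p; lia.
  move: main; rewrite pE.
  by rewrite -signr_odd oddD addbb mul1r.
Qed.

Hypothesis hw' : positive_chebyshev I (init w).

(** The rank of [t] is [q] in [x] and [q + 1] once [s] has been inserted, in
    determinants of orders [m.+1] and [m.+2]: the two sorting signs coincide,
    and they cancel in [divided_differenceB]. *)
Lemma divided_difference_le x s t :
  (forall z, increasing_in I z -> 0 <= D w z f) -> increasing_in I x ->
  I s -> ~ range x s -> I t -> ~ range x t -> s < t ->
  divided_difference w (append x s) f <= divided_difference w (append x t) f.
Proof.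
move=> Dge0 xI Is sx It tx st.
have [p px] := rank_exists xI sx; have [q qx] := rank_exists xI tx.
have yI := increasing_insert xI Is px.
have Vy := hw.2 _ yI.
have zI := increasing_insert yI It (rank_insert st xI px qx).
have := hw.2 _ (increasing_insert xI It qx); rewrite V_insert => Vt.
have := Dge0 _ zI; rewrite D_insert => Dz.
have Vt0 : V w (append x t) != 0.
  by apply: contraTneq Vt => ->; rewrite mulr0 ltxx.
have e : (-1) ^+ (lift ord0 q + m.+1) = (-1) ^+ (q + m) :> R.
  rewrite -signr_odd -[in RHS]signr_odd; congr (_ ^+ nat_of_bool _).
  by rewrite lift0; lia.
rewrite e in Dz.
have key := divided_differenceB f (positive_chebyshevW hw) yI Vt0.
rewrite -subr_ge0 -(pmulr_lge0 _ Vt) -(pmulr_lge0 _ Vy).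
set a := _ - _ in key *.
have -> : a * ((-1) ^+ (q + m) * V w (append x t)) * V w (insert p x s) =
   (-1) ^+ (q + m) * (a * (V w (insert p x s) * V w (append x t))) by ring.
by rewrite key mulrA mulr_ge0 // ltW // hw'.2.
Qed.

End Convexity.

Lemma between_interior (R : realType) (I : set R) (a b t : R) :
  is_interval I -> I a -> I b -> a < t < b -> interior I t.
Proof.
move=> hI Ia Ib tab; suff : `]a, b[%classic `<=` I°.
  by apply; rewrite /= in_itv.
rewrite -open_subsetE => [u|]; last exact: interval_open.
rewrite /= in_itv /= => /andP[au ub].
by apply: (hI _ _ Ia Ib); rewrite !ltW.
Qed.

Theorem theorem2 (R : realType) (I : set R) (hI : is_interval I)
    (m : nat) (hn : (2 <= m.+1)%N) (w : 'I_m.+1 -> R -> R)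
    (hw : positive_chebyshev I w) (hw' : positive_chebyshev I (init w))
    (f : R -> R) :
  omega_convex I w f <->
  (forall x : 'I_m -> R, increasing_in (interior I) x ->
     {in I `\` range x &,
       {homo (fun t => divided_difference w (append x t) f) :
          s t / s <= t}}).
Proof.
split=> [/(omega_convex_D f hw) Dge0 x xI s t|mono].
  rewrite !inE => -[Is sx] [It tx]; rewrite le_eqVlt => /orP[/eqP-> //|st].
  apply: (divided_difference_le hw hw') => //.
  by split; [move=> i; apply: interior_subset; exact: xI.1|exact: xI.2].
apply/(omega_convex_D f hw) => z zI.
pose s := z ord0; pose t := z ord_max.
pose x i := z (lift ord_max (lift ord0 i)).
have zE : append (insert ord0 x s) t = z.
  rewrite -[RHS](append_init z) init_lift.
  rewrite -[in RHS](insert_split ord0 (fun i => z (lift ord_max i))).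
  by congr (append (insert _ _ (z _)) _); exact/val_inj/esym/lift_max.
have yE : insert ord0 x s = init z by rewrite -zE init_append.
have tE : append x t = (fun i => z (lift ord0 i)).
  rewrite -[RHS](append_init _) init_lift /=.
  by congr (append _ (z _)); [apply/funext => i; congr z|]; apply/val_inj;
    rewrite /= /bump /=; have := ltn_ord; lia.
have yI : increasing_in I (insert ord0 x s).
  by rewrite yE; apply: increasing_sub zI => i j.
have xtI : increasing_in I (append x t).
  by rewrite tE; apply: increasing_sub zI => i j; rewrite /= /bump; lia.
have sx i : s < x i by apply: zI.2; rewrite /= /bump /=; lia.
have xt i : x i < t by apply: zI.2; rewrite lift_max; exact: ltn_ord.
have st : s <= t by rewrite ltW //; apply: zI.2.
have xI : increasing_in I x.
  by apply: increasing_sub zI => i j; rewrite /= /bump; lia.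
have xI0 : increasing_in I° x.
  split=> [i|]; last exact: xI.2.
  by apply: (between_interior hI (zI.1 ord0) (zI.1 ord_max)); rewrite sx xt.
have sIx : s \in I `\` range x.
  rewrite inE; split=> [|[i _ e]]; first exact: zI.1.
  by have := sx i; rewrite e ltxx.
have tIx : t \in I `\` range x.
  rewrite inE; split=> [|[i _ e]]; first exact: zI.1.
  by have := xt i; rewrite e ltxx.
have := mono x xI0 s t sIx tIx st; rewrite -subr_ge0 /= => ge0.
have key := divided_differenceB f (positive_chebyshevW hw) yI
  (lt0r_neq0 (hw.2 _ xtI)).
rewrite -zE -(pmulr_lge0 _ (hw'.2 _ xI)) -key.
by rewrite !mulr_ge0 // ltW // hw.2.
Qed.
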